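(* Let $R$ be one of the chain rings $\mathbb{G}_4=\mathbb{Z}_4[X]/(X^2+X+1)$, $\mathbb{S}_4=\mathbb{F}_4[X]/(X^2)$, $\mathbb{T}_4=\mathbb{F}_4[X;a\mapsto a^2]/(X^2)$. Then $\mathrm{m}_7(R)\le 101$.
   Context: $\mathbb{F}_4[X;a\mapsto a^2]$ denotes the skew polynomial ring with commutation rule $Xa=a^2X$. For a finite chain ring $R$ of length $2$ with residue field $\mathbb{F}_q$, the projective Hjelmslev plane $\mathrm{PHG}(2,R)$ is the incidence structure whose points are the free rank-$1$ submodules of the right module $R_R^3$, whose lines are the free rank-$2$ submodules of $R_R^3$, with incidence given by inclusion. A projective $(k,n)$-arc is a set of $k$ points meeting every line in at most $n$ points. For $0\le n\le q^2+q$, $\mathrm{m}_n(R)$ denotes the largest $k$ such that a projective $(k,n)$-arc exists in $\mathrm{PHG}(2,R)$. *)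

(* Defs.v *)
From HB Require Import structures.
From mathcomp Require Import all_boot all_order all_algebra.
From mathcomp Require Import ring.

Set Implicit Arguments.
Unset Strict Implicit.
Unset Printing Implicit Defensive.

Import GRing.Theory.
Local Open Scope ring_scope.

(* The field F_4 = {0, 1, w, w^2} with w^2 = w + 1.                     *)

Inductive F4 := F0 | F1 | Fw | Fw2.

Definition F4_to_nat (x : F4) : nat :=
  match x with F0 => 0 | F1 => 1 | Fw => 2 | Fw2 => 3 end.
Definition F4_of_nat (n : nat) : F4 :=
  match n with 0 => F0 | 1 => F1 | 2 => Fw | _ => Fw2 end.
Lemma F4_natK : cancel F4_to_nat F4_of_nat. Proof. by case. Qed.

HB.instance Definition _ := Countable.copy F4 (can_type F4_natK).

Lemma F4_enumP : Finite.axiom [:: F0; F1; Fw; Fw2]. Proof. by case. Qed.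
HB.instance Definition _ := isFinite.Build F4 F4_enumP.

Definition F4add (x y : F4) : F4 :=
  match x, y with
  | F0, z | z, F0 => z
  | F1, F1 | Fw, Fw | Fw2, Fw2 => F0
  | F1, Fw | Fw, F1 => Fw2
  | F1, Fw2 | Fw2, F1 => Fw
  | Fw, Fw2 | Fw2, Fw => F1
  end.
Definition F4opp (x : F4) : F4 := x.
Definition F4mul (x y : F4) : F4 :=
  match x, y with
  | F0, _ | _, F0 => F0
  | F1, z | z, F1 => z
  | Fw, Fw => Fw2
  | Fw, Fw2 | Fw2, Fw => F1
  | Fw2, Fw2 => Fw
  end.
Definition F4inv (x : F4) : F4 :=
  match x with F0 => F0 | F1 => F1 | Fw => Fw2 | Fw2 => Fw end.

Lemma F4addA : associative F4add. Proof. by do 3!case. Qed.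
Lemma F4addC : commutative F4add. Proof. by do 2!case. Qed.
Lemma F4add0 : left_id F0 F4add. Proof. by case. Qed.
Lemma F4addN : left_inverse F0 F4opp F4add. Proof. by case. Qed.
HB.instance Definition _ :=
  GRing.isZmodule.Build F4 F4addA F4addC F4add0 F4addN.

Lemma F4mulA : associative F4mul. Proof. by do 3!case. Qed.
Lemma F4mulC : commutative F4mul. Proof. by do 2!case. Qed.
Lemma F4mul1 : left_id F1 F4mul. Proof. by case. Qed.
Lemma F4mulDl : left_distributive F4mul F4add. Proof. by do 3!case. Qed.
Lemma F4_1n0 : F1 != F0. Proof. by []. Qed.
HB.instance Definition _ :=
  GRing.Zmodule_isComNzRing.Build F4 F4mulA F4mulC F4mul1 F4mulDl F4_1n0.

Lemma F4mulV (x : F4) : x != 0 -> F4inv x * x = 1. Proof. by case: x. Qed.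
Lemma F4inv0 : F4inv 0 = 0. Proof. by []. Qed.
HB.instance Definition _ := GRing.ComNzRing_isField.Build F4 F4mulV F4inv0.

Lemma F4_card : #|{: F4}| = 4%N.
Proof. by rewrite cardT enumT unlock. Qed.

Lemma F4frobD (a b : F4) : (a + b) ^+ 2 = a ^+ 2 + b ^+ 2.
Proof. by case: a; case: b. Qed.

(* S_4 = F_4[X]/(X^2): elements a + bX, X central, X^2 = 0.           *)

Inductive S4 := S4mk of F4 & F4.
Definition S4_to (x : S4) : F4 * F4 := let: S4mk a b := x in (a, b).
Definition S4_of (p : F4 * F4) : S4 := S4mk p.1 p.2.
Lemma S4_toK : cancel S4_to S4_of. Proof. by case. Qed.
HB.instance Definition _ := Countable.copy S4 (can_type S4_toK).
HB.instance Definition _ := Finite.copy S4 (can_type S4_toK).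

Definition S4add (x y : S4) := let: S4mk a b := x in let: S4mk c d := y in
  S4mk (a + c) (b + d).
Definition S4opp (x : S4) := let: S4mk a b := x in S4mk (- a) (- b).
Definition S4zero := S4mk 0 0.
(* (a + bX)(c + dX) = ac + (ad + bc) X *)
Definition S4mul (x y : S4) := let: S4mk a b := x in let: S4mk c d := y in
  S4mk (a * c) (a * d + b * c).
Definition S4one := S4mk 1 0.

Lemma S4addA : associative S4add.
Proof. by move=> [a b] [c d] [e f] /=; rewrite !addrA. Qed.
Lemma S4addC : commutative S4add.
Proof. by move=> [a b] [c d] /=; rewrite addrC [b + _]addrC. Qed.
Lemma S4add0 : left_id S4zero S4add.
Proof. by move=> [a b] /=; rewrite !add0r. Qed.
Lemma S4addN : left_inverse S4zero S4opp S4add.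
Proof. by move=> [a b] /=; rewrite !addNr. Qed.
HB.instance Definition _ :=
  GRing.isZmodule.Build S4 S4addA S4addC S4add0 S4addN.

Lemma S4mulA : associative S4mul.
Proof. by move=> [a b] [c d] [e f] /=; congr S4mk; ring. Qed.
Lemma S4mulC : commutative S4mul.
Proof. by move=> [a b] [c d] /=; congr S4mk; ring. Qed.
Lemma S4mul1 : left_id S4one S4mul.
Proof. by move=> [a b] /=; congr S4mk; ring. Qed.
Lemma S4mulDl : left_distributive S4mul S4add.
Proof. by move=> [a b] [c d] [e f] /=; congr S4mk; ring. Qed.
Lemma S4_1n0 : S4one != S4zero. Proof. by []. Qed.
HB.instance Definition _ :=
  GRing.Zmodule_isComNzRing.Build S4 S4mulA S4mulC S4mul1 S4mulDl S4_1n0.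

(* T_4 = F_4[X; a |-> a^2]/(X^2): elements a + bX, X a = a^2 X, X^2=0. *)

Inductive T4 := T4mk of F4 & F4.
Definition T4_to (x : T4) : F4 * F4 := let: T4mk a b := x in (a, b).
Definition T4_of (p : F4 * F4) : T4 := T4mk p.1 p.2.
Lemma T4_toK : cancel T4_to T4_of. Proof. by case. Qed.
HB.instance Definition _ := Countable.copy T4 (can_type T4_toK).
HB.instance Definition _ := Finite.copy T4 (can_type T4_toK).

Definition T4add (x y : T4) := let: T4mk a b := x in let: T4mk c d := y in
  T4mk (a + c) (b + d).
Definition T4opp (x : T4) := let: T4mk a b := x in T4mk (- a) (- b).
Definition T4zero := T4mk 0 0.
(* (a + bX)(c + dX) = ac + (ad + b c^2) X *)
Definition T4mul (x y : T4) := let: T4mk a b := x in let: T4mk c d := y in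
  T4mk (a * c) (a * d + b * c ^+ 2).
Definition T4one := T4mk 1 0.

Lemma T4addA : associative T4add.
Proof. by move=> [a b] [c d] [e f] /=; rewrite !addrA. Qed.
Lemma T4addC : commutative T4add.
Proof. by move=> [a b] [c d] /=; rewrite addrC [b + _]addrC. Qed.
Lemma T4add0 : left_id T4zero T4add.
Proof. by move=> [a b] /=; rewrite !add0r. Qed.
Lemma T4addN : left_inverse T4zero T4opp T4add.
Proof. by move=> [a b] /=; rewrite !addNr. Qed.
HB.instance Definition _ :=
  GRing.isZmodule.Build T4 T4addA T4addC T4add0 T4addN.

Lemma T4mulA : associative T4mul.
Proof. by move=> [a b] [c d] [e f] /=; congr T4mk; ring. Qed.
Lemma T4mul1 : left_id T4one T4mul.
Proof. by move=> [a b] /=; congr T4mk; ring. Qed.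
Lemma T4mulr1 : right_id T4one T4mul.
Proof. by move=> [a b] /=; congr T4mk; ring. Qed.
Lemma T4mulDl : left_distributive T4mul T4add.
Proof. by move=> [a b] [c d] [e f] /=; congr T4mk; ring. Qed.
Lemma T4mulDr : right_distributive T4mul T4add.
Proof. by move=> [a b] [c d] [e f] /=; rewrite F4frobD; congr T4mk; ring. Qed.
Lemma T4_1n0 : T4one != T4zero. Proof. by []. Qed.
HB.instance Definition _ :=
  GRing.Zmodule_isNzRing.Build T4 T4mulA T4mul1 T4mulr1 T4mulDl T4mulDr T4_1n0.

(* G_4 = Z_4[X]/(X^2+X+1): elements a + b w with w^2 = -1 - w.         *)

Inductive G4 := G4mk of 'Z_4 & 'Z_4.
Definition G4_to (x : G4) : 'Z_4 * 'Z_4 := let: G4mk a b := x in (a, b).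
Definition G4_of (p : 'Z_4 * 'Z_4) : G4 := G4mk p.1 p.2.
Lemma G4_toK : cancel G4_to G4_of. Proof. by case. Qed.
HB.instance Definition _ := Countable.copy G4 (can_type G4_toK).
HB.instance Definition _ := Finite.copy G4 (can_type G4_toK).

Definition G4add (x y : G4) := let: G4mk a b := x in let: G4mk c d := y in
  G4mk (a + c) (b + d).
Definition G4opp (x : G4) := let: G4mk a b := x in G4mk (- a) (- b).
Definition G4zero := G4mk 0 0.
(* (a + bw)(c + dw) = (ac - bd) + (ad + bc - bd) w *)
Definition G4mul (x y : G4) := let: G4mk a b := x in let: G4mk c d := y in
  G4mk (a * c - b * d) (a * d + b * c - b * d).
Definition G4one := G4mk 1 0.

Lemma G4addA : associative G4add.
Proof. by move=> [a b] [c d] [e f] /=; rewrite !addrA. Qed.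
Lemma G4addC : commutative G4add.
Proof. by move=> [a b] [c d] /=; rewrite addrC [b + _]addrC. Qed.
Lemma G4add0 : left_id G4zero G4add.
Proof. by move=> [a b] /=; rewrite !add0r. Qed.
Lemma G4addN : left_inverse G4zero G4opp G4add.
Proof. by move=> [a b] /=; rewrite !addNr. Qed.
HB.instance Definition _ :=
  GRing.isZmodule.Build G4 G4addA G4addC G4add0 G4addN.

Lemma G4mulA : associative G4mul.
Proof. by move=> [a b] [c d] [e f] /=; congr G4mk; ring. Qed.
Lemma G4mulC : commutative G4mul.
Proof. by move=> [a b] [c d] /=; congr G4mk; ring. Qed.
Lemma G4mul1 : left_id G4one G4mul.
Proof. by move=> [a b] /=; congr G4mk; ring. Qed.
Lemma G4mulDl : left_distributive G4mul G4add.
Proof. by move=> [a b] [c d] [e f] /=; congr G4mk; ring. Qed.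
Lemma G4_1n0 : G4one != G4zero. Proof. by []. Qed.
HB.instance Definition _ :=
  GRing.Zmodule_isComNzRing.Build G4 G4mulA G4mulC G4mul1 G4mulDl G4_1n0.

(* Vectors of R^3 are row vectors 'rV[R]_3; R^3 is a RIGHT R-module.   *)

Definition rscale (R : finNzRingType) (x : 'rV[R]_3) (r : R) : 'rV[R]_3 :=
  \row_i (x 0 i * r).

Definition rcomb (R : finNzRingType) (k : nat)
    (B : {ffun 'I_k -> 'rV[R]_3}) (c : {ffun 'I_k -> R}) : 'rV[R]_3 :=
  \sum_(i < k) rscale (B i) (c i).

Definition free_submod (R : finNzRingType) (k : nat) (M : {set 'rV[R]_3}) : bool :=
  [exists B : {ffun 'I_k -> 'rV[R]_3},
     injectiveb (rcomb B) && (M == [set rcomb B c | c : {ffun 'I_k -> R}])].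

Definition PHG_point (R : finNzRingType) (P : {set 'rV[R]_3}) : bool :=
  free_submod 1 P.
Definition PHG_line (R : finNzRingType) (L : {set 'rV[R]_3}) : bool :=
  free_submod 2 L.

Definition proj_arc (R : finNzRingType) (n : nat) (K : {set {set 'rV[R]_3}}) : bool :=
  [forall P in K, PHG_point P] &&
  [forall L : {set 'rV[R]_3}, PHG_line L ==> (#|[set P in K | P \subset L]| <= n)%N].

Definition m_arc (R : finNzRingType) (n : nat) : nat :=
  \max_(K : {set {set 'rV[R]_3}} | proj_arc n K) #|K|.

(* Main.v *)
Require Import Defs.
From mathcomp Require Import all_boot all_order all_algebra.
From mathcomp Require Import ring zify.

(** The neighbour classes of points form PG(2,4), and each class carries an
    AG(2,4) whose five parallel classes correspond to the line classes through
    it; dually, the 16 lines of a line class [L] form an AG(2,4) whose parallel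
    classes correspond to the five point classes on [L].  Suppose an arc has 102
    points; let [u P] be its number of points in the class [P], and [T L] the sum
    of the [u P] over the [P] on [L].  The four lines of [L] through a segment of
    [P] with [s] arc points partition the other point classes of [L], so
    [T L + 4 s <= 28 + u P].  Summing over the five [L] through [P] leaves only
    [u P <= 6]; six points form a hyperoval (segments 2220 in each direction) or
    two triples on parallel segments (3300, 2220 and three times 2211), and five
    points have segments 2210 in each direction.  All [T L] are at most 26, and
    two triples force [T L = 22] in their direction and [T L = 26] in the other
    four.  A line class with [T L = 26] contains exactly three classes of type
    2211 and at most one of type 2220, and in the latter case the fifth class has
    two points.  Counting flags, there are as many line classes with [T L = 26]
    as two-triple classes, so each contains four of them and one class with two
    points.  From this the line classes with [T L = 22] through a two-triple class
    must be of type 6,6,6,2,2, which the AG(2,4) of [L] rules out.  Hence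
    [T L <= 25] and there are no classes with six points, so some line class is
    of type 5,5,5,5,5, which is again ruled out in the AG(2,4) of [L]. *)

Set Implicit Arguments.
Unset Strict Implicit.
Unset Printing Implicit Defensive.

Import GRing.Theory.

(** * The affine plane AG(2,4) and lists of natural numbers *)

Definition elts := [:: F0; F1; Fw; Fw2].
Definition dirs := [:: None; Some F0; Some F1; Some Fw; Some Fw2].
Definition pts16 := [seq (x, y) | x <- elts, y <- elts].

(* The parallel classes of AG(2,4): [lin d] is constant exactly on the lines of
   slope [d], where [None] is the vertical slope. *)
Definition lin (d : option F4) (a : F4 * F4) : F4 :=
  if d is Some t then F4add a.1 (F4mul t a.2) else a.2.

Definition values (f : F4 -> nat) := [seq f t | t <- elts].
Definition profile (f : F4 -> nat) := sort geq (values f).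
Definition maxl (s : seq nat) := foldr maxn 0 s.
Definition summax (st : seq (seq nat)) := sumn [seq maxl s | s <- st].

Lemma mem_dirs d : d \in dirs. Proof. by case: d => [[]|]. Qed.
Lemma mem_pts16 a : a \in pts16. Proof. by case: a => [[][]]. Qed.

Lemma mem_leq_maxl s x : x \in s -> x <= maxl s.
Proof.
elim: s => //= y s IH; rewrite inE => /predU1P [->|/IH]; first exact: leq_maxl.
by move=> le; rewrite leq_max le orbT.
Qed.

Lemma maxl_leP s m : reflect {in s, forall x, x <= m} (maxl s <= m).
Proof.
apply: (iffP idP) => [le x /mem_leq_maxl/leq_trans|]; first exact.
elim: s => //= y s IH le; rewrite geq_max le ?mem_head //=.
by apply: IH => x xs; rewrite le // inE xs orbT.
Qed.

Lemma maxl_perm s1 s2 : perm_eq s1 s2 -> maxl s1 = maxl s2.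
Proof.
move=> /perm_mem eq12; apply/eqP; rewrite eqn_leq.
by apply/andP; split; apply/maxl_leP => x; [rewrite eq12|rewrite -eq12];
  apply: mem_leq_maxl.
Qed.

Lemma sort_geqP s1 s2 : reflect (sort geq s1 = sort geq s2) (perm_eq s1 s2).
Proof.
apply: perm_sortP => [x y|x y z|x y]; first exact: leq_total.
- by move=> xy zx; apply: leq_trans xy.
- by rewrite andbC; apply: anti_leq.
Qed.

Lemma perm_profile f : perm_eq (profile f) (values f).
Proof. by rewrite perm_sort. Qed.

Lemma sumn_perm s1 s2 : perm_eq s1 s2 -> sumn s1 = sumn s2.
Proof. by rewrite !sumnE; apply: perm_big. Qed.

Lemma sumn_profile f : sumn (profile f) = sumn (values f).
Proof. exact/sumn_perm/perm_profile. Qed.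

Lemma maxl_profile f : maxl (profile f) = maxl (values f).
Proof. exact/maxl_perm/perm_profile. Qed.

(** * Point classes: subsets of AG(2,4) *)

Definition seg (U : pred (F4 * F4)) (d : option F4) (t : F4) : nat :=
  count (fun a => U a && (lin d a == t)) pts16.

Definition hyperoval_prof (ps : seq (seq nat)) := all (pred1 [:: 2; 2; 2; 0]) ps.
Definition two_triples_prof (ps : seq (seq nat)) :=
  [&& count_mem [:: 3; 3; 0; 0] ps == 1, count_mem [:: 2; 2; 2; 0] ps == 1
    & count_mem [:: 2; 2; 1; 1] ps == 3].

Definition class_spec (n : nat) (ps : seq (seq nat)) :=
  [&& n <= 6,
      (n == 6) ==> hyperoval_prof ps || two_triples_prof ps
    & (n == 5) ==> all (pred1 [:: 2; 2; 1; 0]) ps].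

Definition bump (a : F4 * F4) (st : seq (seq nat)) :=
  [seq incr_nth x.2 (F4_to_nat (lin x.1 a)) | x <- zip dirs st].

(* The cut-off is sound because adding the remaining points never lowers [summax]
   and raises the size by at most [size ps]. *)
Fixpoint class_search (ps : seq (F4 * F4)) (st : seq (seq nat)) (n : nat) :=
  if 38 + n + size ps < 4 * summax st then true else
  if ps is a :: ps' then
    class_search ps' st n && class_search ps' (bump a st) n.+1
  else class_spec n [seq sort geq s | s <- st].

Definition table (f : option F4 -> F4 -> nat) := [seq values (f d) | d <- dirs].

Lemma eq_table f g : f =2 g -> table f = table g.
Proof.
by move=> e; apply: eq_map => d; apply: eq_map => t.
Qed.

Definition profs (f : option F4 -> F4 -> nat) := [seq profile (f d) | d <- dirs].

Lemma eq_profs f g : f =2 g -> profs f = profs g.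
Proof.
by move=> e; apply: eq_map => d; rewrite /profile; congr sort; apply: eq_map => t.
Qed.

Lemma bump_table a f :
  bump a (table f) = table (fun d t => f d t + (lin d a == t)).
Proof. by case: a => [[] []]; rewrite /table /bump /values /= !addn0 !addn1. Qed.

Lemma maxl_incr f g : (forall t, f t <= g t) -> maxl (values f) <= maxl (values g).
Proof. by move=> le; rewrite /= !geq_max !leq_max !le ?orbT. Qed.

Lemma leq_summax f g :
  (forall d t, f d t <= g d t) -> summax (table f) <= summax (table g).
Proof.
move=> le; rewrite /table /summax -!map_comp !sumnE !big_map.
by apply: leq_sum => d _; apply: maxl_incr.
Qed.

(** Induction on the points still undecided: [f] counts the [n] points already selected, and [g] is
    the table of the completed set. *)
Lemma class_searchP U ps f n : class_search ps (table f) n ->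
  let g d t := f d t + count (fun a => U a && (lin d a == t)) ps in
  4 * summax (table g) <= 38 + (n + count U ps) ->
  class_spec (n + count U ps) (profs g).
Proof.
elim: ps f n => [|a ps IH] f n /=.
  have e d t : f d t + 0 = f d t by rewrite addn0.
  rewrite (eq_table e) (eq_profs e); case: ifP => [|_ S _].
    by move=> lt _; lia.
  by rewrite addn0; exact: S.
case: ifP => [lt _|_ /andP [s1 s2]] le.
  have le' : 4 * summax (table f) <= 38 + (n + (U a + count U ps)).
    apply: leq_trans le; rewrite leq_mul2l; apply: leq_summax => d t.
    exact: leq_addr.
  by have := count_size U ps; case: (U a) => /=; lia.
case: (boolP (U a)) le => Ua le /=; last by move: le; rewrite !add0n; apply: IH.
have e d t :
  f d t + (true && (lin d a == t) + count (fun a => U a && (lin d a == t)) ps)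
  = f d t + (lin d a == t) + count (fun a => U a && (lin d a == t)) ps.
  by rewrite addnA.
rewrite bump_table in s2; move: le; rewrite (eq_table e) (eq_profs e).
by rewrite (addnA n) addn1; apply: IH.
Qed.

Lemma class_search_true : class_search pts16 (table (fun _ _ => 0)) 0.
Proof. by vm_compute. Qed.

(** The hypothesis is the bound [T L + 4 * maxl (S P L) <= 28 + u P] summed over the five line
    classes through a point class: the [T L] add up to [102 + 4 * u P], and [5 * 28 - 102 = 38]. *)
Lemma class_classification (U : pred (F4 * F4)) :
  4 * summax (table (seg U)) <= 38 + count U pts16 ->
  class_spec (count U pts16) (profs (seg U)).
Proof. exact: (class_searchP class_search_true). Qed.

(** * Line classes: weights on the lines of AG(2,4) *)

(** The points [b] are the lines of one line class, and [w d t] counts the arc points on the segment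
    shared by those with [lin d b = t]. *)
Definition net7 (w : option F4 -> F4 -> nat) :=
  forall b, sumn [seq w d (lin d b) | d <- dirs] <= 7.

Lemma net7P w : net7 w -> forall x,
  let load y := w None y + w (Some F0) (lin (Some F0) (x, y)) +
    w (Some F1) (lin (Some F1) (x, y)) + w (Some Fw) (lin (Some Fw) (x, y)) +
    w (Some Fw2) (lin (Some Fw2) (x, y)) in
  [/\ load F0 <= 7, load F1 <= 7, load Fw <= 7 & load Fw2 <= 7].
Proof.
move=> H x /=; split.
- by have := H (x, F0); rewrite /= addn0 !addnA.
- by have := H (x, F1); rewrite /= addn0 !addnA.
- by have := H (x, Fw); rewrite /= addn0 !addnA.
- by have := H (x, Fw2); rewrite /= addn0 !addnA.
Qed.

Definition total (w : option F4 -> F4 -> nat) :=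
  sumn [seq sumn (values (w d)) | d <- dirs].

(* The four points on the line [lin d = t] meet every line of another slope
   exactly once. *)
Lemma net_line_bound w d t : net7 w ->
  total w + 4 * w d t <= 28 + sumn (values (w d)).
Proof.
move=> /net7P H; have [[? ? ? ?] [? ? ? ?]] := (H F0, H F1).
have [[? ? ? ?] [? ? ? ?]] := (H Fw, H Fw2).
rewrite /total; case: d t => [[]|] [];
by simpl in *; lia.
Qed.

Lemma net_maxl_bound w d : net7 w ->
  total w + 4 * maxl (values (w d)) <= 28 + sumn (values (w d)).
Proof.
move=> H; have := fun t => @net_line_bound w d t H.
move: (total w) (w d) => T f le.
by move: (le F0) (le F1) (le Fw) (le Fw2) => /=; lia.
Qed.

Definition contrib (d : option F4) (p : seq nat) :=
  [seq nth 0 p (F4_to_nat (lin d b)) | b <- pts16].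
Definition addl (s1 s2 : seq nat) := [seq x.1 + x.2 | x <- zip s1 s2].

(** One slope is filled at a time. A branch is cut when the missing weight is negative or exceeds 6
    for each remaining slope, or when a load exceeds 7, since loads only grow. *)
Fixpoint net_search (pats : seq (seq nat)) (leaf : seq (seq nat) -> bool)
    (ds : seq (option F4)) (acc : seq (seq nat)) (load : seq nat) (need : nat) :=
  if ds is d :: ds' then
    all (fun p =>
      if (need < sumn p) || (sumn p + 6 * size ds' < need) then true else
      let load' := addl load (contrib d p) in
      if all (geq 7) load' then
        net_search pats leaf ds' (rcons acc p) load' (need - sumn p)
      else true) pats
  else (need == 0) ==> leaf acc.

Lemma all_addl s1 s2 : size s1 = size s2 ->
  all (geq 7) (addl s1 s2) -> all (geq 7) s1.
Proof.
elim: s1 s2 => [|x s1 IH] [|y s2] //= [/IH {}IH] /andP [le /IH ->].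
by rewrite andbT; lia.
Qed.

Definition final_load (p : option F4 -> seq nat) ds load :=
  foldl (fun l d => addl l (contrib d (p d))) load ds.

Lemma all_final_load p ds load : size load = 16 ->
  all (geq 7) (final_load p ds load) -> all (geq 7) load.
Proof.
elim: ds load => //= d ds IH load s16 /IH; rewrite size_map size_zip s16.
by move=> /(_ erefl); apply: all_addl; rewrite s16.
Qed.

Lemma net_searchP pats leaf ds acc load p need :
  all (fun s => sumn s <= 6) pats -> size load = 16 ->
  net_search pats leaf ds acc load need ->
  (forall d, d \in ds -> p d \in pats) ->
  sumn [seq sumn (p d) | d <- ds] = need ->
  all (geq 7) (final_load p ds load) ->
  leaf (acc ++ [seq p d | d <- ds]).
Proof.
move=> /allP le6; elim: ds acc load need => [|d ds IH] acc load need s16 /=.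
  by move=> S _ need0 _; move: S; rewrite -need0 cats0.
move=> S inp needE fin; rewrite -needE in S; have := allP S _ (inp d (mem_head _ _)).
have inp' e : e \in ds -> p e \in pats by move=> eds; rewrite inp // inE eds orbT.
have le: sumn [seq sumn (p d) | d <- ds] <= 6 * size ds.
  elim: (ds) inp' => //= e es IHe inp'.
  rewrite mulnS leq_add ?IHe ?le6 ?inp' ?mem_head // => x xs.
  by rewrite inp' // inE xs orbT.
rewrite ltnNge leq_addr /= ltnNge leq_add2l le /=.
have s16' : size (addl load (contrib d (p d))) = 16.
  by rewrite size_map size_zip s16.
rewrite (all_final_load s16' fin) addKn => {}S.
by rewrite -cat_rcons; apply: (IH _ _ _ s16' S inp' erefl fin).
Qed.

Lemma net_search_sound pats leaf need w :
  all (fun s => sumn s <= 6) pats ->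
  net_search pats leaf dirs [::] (nseq 16 0) need ->
  net7 w -> total w = need -> (forall d, values (w d) \in pats) ->
  leaf (table w).
Proof.
move=> le6 S H T inp; apply: (net_searchP (p := fun d => values (w d)) le6 _ S) => //.
move/net7P: H => H; have [[? ? ? ?] [? ? ? ?]] := (H F0, H F1).
have [[? ? ? ?] [? ? ? ?]] := (H Fw, H Fw2).
by rewrite /= /geq; simpl in *; lia.
Qed.

Definition words (m : nat) : seq (seq nat) :=
  let r := iota 0 m.+1 in
  [seq x :: s | x <- r,
     s <- [seq x :: s | x <- r, s <- [seq [:: x; y] | x <- r, y <- r]]].

Lemma mem_words m f : maxl (values f) <= m -> values f \in words m.
Proof.
rewrite /values /= => le.
do 3!(apply: allpairs_f; first by rewrite mem_iota; lia).
by rewrite mem_iota; lia.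
Qed.

Definition line26_prof (ps : seq (seq nat)) :=
  (count_mem [:: 2; 2; 1; 1] ps == 3) &&
  ((count_mem [:: 2; 2; 2; 0] ps == 1) && (count_mem [:: 1; 1; 0; 0] ps == 1)
  || (count_mem [:: 2; 2; 2; 0] ps == 0)).

(** For total weight 26, [net_maxl_bound] reads [4 * maxl s <= 2 + sumn s]; with sum at most 6 this
    caps the entries at 2. *)
Definition pats26 :=
  [seq s <- words 2 | (sumn s <= 6) && (4 * maxl s <= 2 + sumn s)].
Definition pats22 :=
  [seq s <- words 3 | (sort geq s == [:: 3; 3; 0; 0]) || (sumn s == 2)].
Definition pats25 := [seq s <- words 2 | sort geq s == [:: 2; 2; 1; 0]].

Lemma net_search26 :
  net_search pats26 (fun ps => line26_prof [seq sort geq p | p <- ps])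
    dirs [::] (nseq 16 0) 26.
Proof. by vm_compute. Qed.

Lemma net_search22 :
  net_search pats22 (fun=> false) dirs [::] (nseq 16 0) 22.
Proof. by vm_compute. Qed.

Lemma net_search25 :
  net_search pats25 (fun=> false) dirs [::] (nseq 16 0) 25.
Proof. by vm_compute. Qed.

Lemma net_total26 w : net7 w -> total w = 26 ->
  (forall d, sumn (values (w d)) <= 6) ->
  line26_prof (profs w).
Proof.
move=> H T le6; have -> : profs w = [seq sort geq p | p <- table w] by rewrite /table -map_comp.
apply: (net_search_sound _ net_search26 H T) => // d; have := net_maxl_bound d H; have := le6 d.
rewrite T mem_filter => ? ?; rewrite mem_words; last by lia.
by rewrite andbT; apply/andP; split; lia.
Qed.

Lemma net_total22 w : net7 w -> total w = 22 ->
  ~ (forall d, profile (w d) = [:: 3; 3; 0; 0] \/ sumn (values (w d)) = 2).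
Proof.
move=> H T h; suff: false by []; apply: (net_search_sound _ net_search22 H T) => // d.
rewrite mem_filter -/(profile _).
case: (h d) => [e|e]; rewrite e ?eqxx ?orbT mem_words // -?maxl_profile ?e //.
by rewrite maxl_profile; move: e => /=; lia.
Qed.

Lemma net_total25 w : net7 w ->
  ~ (forall d, profile (w d) = [:: 2; 2; 1; 0]).
Proof.
move=> H h; have T : total w = 25.
  by rewrite /total -(eq_map (fun d => sumn_profile (w d))) (eq_map (fun d => f_equal sumn (h d))).
suff: false by []; apply: (net_search_sound _ net_search25 H T) => // d.
rewrite mem_filter -/(profile _) h eqxx mem_words //.
by rewrite -maxl_profile h.
Qed.

(** * The factor plane *)

(** Equality of sums for every [F] makes [f] an enumeration of [A] without repetition; indicator
    functions recover membership and surjectivity. *)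
Definition pencil (V : finType) (f : option F4 -> V) (A : pred V) :=
  forall F : V -> nat, \sum_(v | A v) F v = \sum_(d <- dirs) F (f d).

Section Pencil.
Variables (V : finType) (f : option F4 -> V) (A : pred V).
Hypothesis fA : pencil f A.

Lemma pencil_mem d : A (f d).
Proof.
have := fA (fun v => ~~ A v); rewrite big1 => [|v ->] //.
by move/esym/eqP; rewrite sum_nat_seq_eq0 => /allP/(_ _ (mem_dirs d)); case: (A _).
Qed.

Lemma pencilP v : A v -> exists d, v = f d.
Proof.
move=> Av; have := fA (fun x => x == v : nat).
rewrite (bigD1 v) //= eqxx => e.
have : has (fun d => f d == v) dirs.
  apply: contraT; rewrite -all_predC => /allP h.
  by move: e; rewrite [RHS]big_seq [RHS]big1 // => d /h /= /negbTE ->.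
by case/hasP => d _ /eqP; exists d.
Qed.

Lemma pencil_count (T : eqType) (g : V -> T) x :
  \sum_(v | A v) (g v == x) = count_mem x [seq g (f d) | d <- dirs].
Proof.
rewrite fA count_map -sum1_count [RHS]big_mkcond.
by apply: eq_bigr => d _ /=; case: eqP.
Qed.

End Pencil.

(* [S P L] is the profile of the point class [P] in the direction of the line
   class [L], and [u P] the number of arc points in [P]. *)
Record hjelmslev_arc (V : finType) (inc : rel V) (S : V -> V -> seq nat)
    (u : V -> nat) : Prop := HjelmslevArc {
  inc_sym : symmetric inc;
  card_plane : #|V| = 21;
  plane_sum : forall (P : V) (F : V -> nat),
    \sum_(L | inc P L) \sum_(Q | inc L Q) F Q = \sum_Q F Q + 4 * F P;
  point_class : forall P, exists U f, [/\ pencil f (inc P),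
    forall d, S P (f d) = profile (seg U d) & u P = count U pts16];
  line_class : forall L, exists w f, [/\ pencil f (inc L),
    forall d, S (f d) L = profile (w d),
    forall d, u (f d) = sumn (values (w d)) & net7 w] }.

(** * The counting argument against 102 arc points *)

Section Arc102.

Variables (V : finType) (inc : rel V) (S : V -> V -> seq nat) (u : V -> nat).
Hypothesis arc : hjelmslev_arc inc S u.
Hypothesis sum_u : \sum_P u P = 102.

Notation p3300 := [:: 3; 3; 0; 0].
Notation p2220 := [:: 2; 2; 2; 0].
Notation p2211 := [:: 2; 2; 1; 1].

Let T L := \sum_(P | inc L P) u P.

Let sum_T P : \sum_(L | inc P L) T L = 102 + 4 * u P.
Proof. by rewrite /T (plane_sum arc) sum_u. Qed.

Let sum_count (N : pred V) P :
  \sum_(L | inc P L) \sum_(Q | inc L Q) N Q = \sum_Q N Q + 4 * N P.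
Proof. exact: (plane_sum arc P (fun Q => N Q)). Qed.

Let max_bound P L : inc P L -> T L + 4 * maxl (S P L) <= 28 + u P.
Proof.
rewrite (inc_sym arc) => LP; have [w [f [fL Sw uw w7]]] := line_class arc L.
have [d ->] := pencilP fL LP.
rewrite Sw uw maxl_profile; have := net_maxl_bound d w7; congr (_ + _ <= _).
by rewrite /T fL /total sumnE big_map; apply: eq_bigr => e _; rewrite uw.
Qed.

Let sumn_S P L : inc P L -> sumn (S P L) = u P.
Proof.
rewrite (inc_sym arc) => LP; have [w [f [fL Sw uw w7]]] := line_class arc L.
by have [d ->] := pencilP fL LP; rewrite Sw uw sumn_profile.
Qed.

Let sum_const P m : \sum_(L | inc P L) m = 5 * m.
Proof.
have [U [f [fP _ _]]] := point_class arc P.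
by rewrite (fP (fun=> m)) /dirs !big_cons big_nil; lia.
Qed.

Let cnt P p := \sum_(L | inc P L) (S P L == p).
Let lcnt L p := \sum_(P | inc L P) (S P L == p).

Let class_types P : [/\ u P <= 6,
  u P = 6 -> cnt P p2220 = 5 \/
     [/\ cnt P p3300 = 1, cnt P p2220 = 1 & cnt P p2211 = 3] &
  u P = 5 -> forall L, inc P L -> S P L = [:: 2; 2; 1; 0]].
Proof.
have [U [f [fP Sf uU]]] := point_class arc P.
have le : 4 * summax (table (seg U)) <= 38 + count U pts16.
  rewrite -uU.
  have : \sum_(L | inc P L) (T L + 4 * maxl (S P L)) <= \sum_(L | inc P L) (28 + u P).
    by apply: leq_sum => L; apply: max_bound.
  rewrite big_split /= sum_T sum_const -big_distrr /=.
  have -> : \sum_(L | inc P L) maxl (S P L) = summax (table (seg U)).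
    rewrite (fP (fun L => maxl (S P L))) /summax /table -map_comp sumnE big_map.
    by apply: eq_bigr => d _; rewrite Sf maxl_profile.
  by move: (summax _) => k; lia.
have cE p : cnt P p = count_mem p (profs (seg U)).
  rewrite /cnt (pencil_count fP); congr (count_mem _ _).
  by apply: eq_map => d.
have /and3P [le6 t6 t5] := class_classification le; rewrite uU; split=> //.
- move=> e6; move: t6; rewrite !cE e6 eqxx implyTb => /orP [].
    by rewrite /hyperoval_prof all_count => /eqP ->; left.
  by case/and3P => /eqP -> /eqP -> /eqP ->; right.
- move=> e5 L PL; have [d ->] := pencilP fP PL.
  rewrite Sf; move: t5; rewrite e5 eqxx implyTb => /allP h.
  by apply/eqP/h; apply: (map_f (fun d => profile (seg U d))); apply: mem_dirs.
Qed.

Let u_le6 P : u P <= 6. Proof. by have [] := class_types P. Qed.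

Let maxl_sum s : size s = 4 -> sumn s <= 4 * maxl s.
Proof. by case: s => [|a [|b [|c [|d [|]]]]] //= _; lia. Qed.

Let size_S P L : inc P L -> size (S P L) = 4.
Proof.
move=> PL; have [U [f [fP Sf _]]] := point_class arc P.
by have [d ->] := pencilP fP PL; rewrite Sf size_sort.
Qed.

(** Five points on four parallel segments put two on one of them, so [max_bound] loses at least
    8. *)
Let T_bound P L : inc P L -> 4 < u P -> T L <= 20 + u P.
Proof.
move=> PL u5; have := max_bound PL; have := maxl_sum (size_S PL).
by rewrite (sumn_S PL); lia.
Qed.

Let T_le26 L : T L <= 26.
Proof.
have [/existsP [P /andP [PL u5]]|/existsPn no] :=
  boolP [exists P, inc P L && (4 < u P)].
  by have := T_bound PL u5; have := u_le6 P; lia.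
have : T L <= \sum_(P | inc L P) 4.
  apply: leq_sum => P LP; have := no P.
  by rewrite (inc_sym arc) LP -leqNgt.
by rewrite sum_const; lia.
Qed.

(* A six-point class is either a hyperoval or two triples on parallel lines. *)
Let N P := (u P == 6) && (cnt P p2220 != 5).

Let NP P : N P -> [/\ u P = 6, cnt P p3300 = 1, cnt P p2220 = 1 & cnt P p2211 = 3].
Proof.
case/andP => /eqP u6 /eqP h; have [_ /(_ u6) [//|[? ? ?]] _] := class_types P.
by split.
Qed.

(** The upper bounds 22 (once) and 26 (four times) add up to 126, which is exactly [102 + 4 * 6], so
    each is attained. *)
Let N_T P L : N P -> inc P L ->
  T L = (if S P L == p3300 then 22 else 26).
Proof.
move=> NPp PL; have [u6 c3 _ _] := NP NPp.
pose B L := if S P L == p3300 then 22 else 26.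
have leB M : inc P M -> T M <= B M.
  move=> PM; rewrite /B; case: eqP => // e.
  by have := max_bound PM; rewrite e u6 /=; lia.
have sumB : \sum_(M | inc P M) (B M + 4 * (S P M == p3300)) = 130.
  rewrite -[130]/(5 * 26) -(sum_const P 26); apply: eq_bigr => M _.
  by rewrite /B; case: eqP.
have e : \sum_(M | inc P M) T M = \sum_(M | inc P M) B M.
  by move: sumB; rewrite big_split /= -big_distrr /= -/(cnt P _) c3 sum_T u6; lia.
(* Termwise inequality with equal sums forces equality in every term. *)
have := leqif_sum (fun M PM => leqif_geq (leB M PM)).
move=> [_ /esym]; rewrite -e eqxx => /forall_inP/(_ _ PL) leT.
by apply/eqP; rewrite eqn_leq leT leB.
Qed.

Let line26 L : T L = 26 -> lcnt L p2211 = 3 /\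
  (lcnt L p2220 = 1 /\ lcnt L [:: 1; 1; 0; 0] = 1 \/ lcnt L p2220 = 0).
Proof.
have [w [f [fL Sw uw w7]]] := line_class arc L => T26.
have cE p : lcnt L p = count_mem p (profs w).
  rewrite /lcnt (pencil_count fL (fun P => S P L)); congr (count_mem _ _).
  by apply: eq_map => d.
have tw : total w = 26.
  rewrite -T26 /T fL /total sumnE big_map; apply: eq_bigr => d _; by rewrite uw.
have le6 d : sumn (values (w d)) <= 6 by rewrite -uw.
have := net_total26 w7 tw le6; rewrite /line26_prof !cE.
by case/andP => /eqP -> /orP [/andP [/eqP -> /eqP ->]|/eqP ->]; split=> //; [left|right].
Qed.

(** Such a profile gives six points and excludes the hyperoval, whose five profiles are all 2220. *)
Let S2211_N P L : inc P L -> S P L = p2211 -> N P.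
Proof.
move=> PL e; rewrite /N -(sumn_S PL) e /=; apply/eqP => c5.
have : \sum_(M | inc P M) (S P M == p2220) < \sum_(M | inc P M) 1.
  rewrite (bigD1 L) //= e /= add0n [X in _ < X](bigD1 L) //= ltnS.
  by apply: leq_sum => M _; case: eqP.
by rewrite -/(cnt P p2220) c5 sum_const.
Qed.

Let n := \sum_P N P.
Let m := \sum_L (T L == 26).

Let exch (p : seq nat) :
  \sum_L \sum_(P | inc L P) (N P && (S P L == p)) = \sum_P N P * cnt P p.
Proof.
rewrite (exchange_big_dep predT) //=; apply: eq_bigr => P _.
rewrite /cnt big_distrr /=; apply: eq_big => L; first by rewrite (inc_sym arc).
by case: (N P); case: (S P L == p).
Qed.

(** Flags with profile 2211 are counted twice: three on each two-triple class, three on each line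
    class with [T L = 26], and none elsewhere by [N_T]. *)
Let n_eq_m : n = m.
Proof.
have : \sum_L \sum_(P | inc L P) (N P && (S P L == p2211)) = 3 * m.
  rewrite /m big_distrr /=; apply: eq_bigr => L _.
  case: eqP => T26.
    have [c3 _] := line26 T26; rewrite muln1 -c3; apply: eq_bigr => P LP.
    case: eqP => e; rewrite ?andbF ?andbT //.
    by rewrite (@S2211_N P L) // (inc_sym arc).
  rewrite muln0 big1 // => P LP; case: eqP => e; rewrite ?andbF ?andbT //.
  case NPp: (N P) => //; case: T26.
  by rewrite (N_T NPp) ?e // (inc_sym arc).
rewrite exch (eq_bigr (fun P => 3 * N P)) => [|P _].
  by rewrite -big_distrr /= -/n; lia.
by case NPp: (N P); rewrite ?muln0 //; have [_ _ _ ->] := NP NPp.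
Qed.

(** The flags of two-triple classes with profile 2220 number [n = m], and a line class carries at
    most one, only if [T L = 26]. Hence each of these carries exactly one, which selects the first
    alternative of [line26]. *)
Let line26_strong L : T L = 26 ->
  \sum_(P | inc L P) N P = 4 /\
  (forall P, inc L P -> ~~ N P -> u P = 2).
Proof.
pose g L := \sum_(P | inc L P) (N P && (S P L == p2220)).
have gle M : g M <= (T M == 26).
  case: eqP => [/line26 [_ h]|nT].
    apply: leq_trans (_ : lcnt M p2220 <= 1); last by case: h => [[-> _]|->].
    by apply: leq_sum => P _; case: (N P); case: (_ == _).
  rewrite leqn0 /g big1 // => P MP; case NPp: (N P) => //.
  case: eqP => // e; case: nT.
  by rewrite (N_T NPp) ?e // (inc_sym arc).
have e : \sum_M g M = \sum_M (T M == 26).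
  rewrite -/m -n_eq_m /g exch; apply: eq_bigr => P _.
  by case NPp: (N P) => //; have [_ _ -> _] := NP NPp.
have := leqif_sum (fun M (_ : true) => leqif_geq (gle M)).
move=> [_ /esym]; rewrite -e eqxx => /forallP/= ge T26.
have gL : g L = 1 by have := ge L; have := gle L; rewrite T26 eqxx /=; lia.
have [c2211 [[c2220 c1100]|c0]] := line26 T26; last first.
  have : g L <= lcnt L p2220.
    by apply: leq_sum => P _; case: (N P); case: (_ == _).
  by rewrite gL c0.
have N2220 P : inc L P -> S P L = p2220 -> N P.
  move=> LP eP; apply: contraT => nN.
  have : g L < lcnt L p2220.
    rewrite /g /lcnt (bigD1 P) //= eP (negbTE nN) /= add0n.
    rewrite [X in _ < X](bigD1 P) //= eP /= ltnS.
    by apply: leq_sum => Q _; case: (N Q); case: (_ == _).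
  by rewrite gL c2220.
have N2211 P : inc L P -> S P L = p2211 -> N P.
  by move=> LP; apply: S2211_N; rewrite (inc_sym arc).
(* The counts 3, 1 and 1 exhaust the five point classes, so no other profile occurs on [L]. *)
have c5 : \sum_(P | inc L P) ((S P L == p2211) + (S P L == p2220) +
    (S P L == [:: 1; 1; 0; 0])) = \sum_(P | inc L P) 1.
  by rewrite !big_split /= -!/(lcnt _ _) c2211 c2220 c1100 sum_const.
have all1 P : inc L P -> (S P L == p2211) + (S P L == p2220) +
    (S P L == [:: 1; 1; 0; 0]) = 1.
  have le1 Q : inc L Q -> (S Q L == p2211) + (S Q L == p2220) +
    (S Q L == [:: 1; 1; 0; 0]) <= 1.
    by move=> _; case: eqP => [->//|_]; case: eqP => [->//|_]; case: eqP.
  have := leqif_sum (fun Q LQ => leqif_geq (le1 Q LQ)).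
  move=> [_ /esym]; rewrite c5 eqxx => /forall_inP h LP.
  by apply/eqP; rewrite eqn_leq le1 // h.
split.
  have -> : 4 = lcnt L p2211 + lcnt L p2220 by rewrite c2211 c2220.
  rewrite -big_split /=; apply: eq_bigr => P LP.
  have := all1 P LP.
  case: eqP => [eP _|_]; first by rewrite eP (N2211 P).
  case: eqP => [eP _|_]; first by rewrite (N2220 P).
  case: eqP => // e1 _; case NPp: (N P) => //.
  have [u6 _ _ _] := NP NPp; have PL : inc P L by rewrite (inc_sym arc).
  by have := sumn_S PL; rewrite e1 u6.
move=> P LP nN; have := all1 P LP; have PL : inc P L by rewrite (inc_sym arc).
case: eqP => [eP|_]; first by rewrite (N2211 P) in nN.
case: eqP => [eP|_]; first by rewrite (N2220 P) in nN.
by case: eqP => // eP _; rewrite -(sumn_S PL) eP.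
Qed.

Let N_empty P : ~~ N P.
Proof.
apply/negP => NPp.
(* The pencil of [R] counts [R] five times and other classes once: [n + 4] equals the number on [L]
   plus four for each of the other four line classes. *)
have line22 R : N R -> exists L, [/\ inc R L, S R L = p3300, T L = 22
    & \sum_(Q | inc L Q) N Q + 12 = n].
  move=> NR; have [_ c3 _ _] := NP NR.
  have [/existsP [L /andP [RL /eqP e]]|/existsPn no] :=
    boolP [exists L, inc R L && (S R L == p3300)]; last first.
    move: c3; rewrite /cnt big1 // => L RL; have := no L; rewrite RL /=.
    by case: eqP.
  exists L; split=> //; first by rewrite (N_T NR RL) e.
  have uniqL M : inc R M -> M != L -> S R M != p3300.
    move=> RM ML; apply/eqP => e'; move: c3.
    by rewrite /cnt (bigD1 L) //= (bigD1 M) /= ?RM ?ML // e e'.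
  have e4 : \sum_(M | inc R M && (M != L)) \sum_(Q | inc M Q) N Q =
      \sum_(M | inc R M && (M != L)) 4.
    apply: eq_bigr => M /andP [RM ML].
    have TM : T M = 26 by rewrite (N_T NR RM) (negbTE (uniqL M RM ML)).
    by have [] := line26_strong TM.
  have := sum_count N R; rewrite NR /= -/n (bigD1 L) //= e4.
  have := sum_const R 4; rewrite (bigD1 L) //=; lia.
have [L [PL eL TL cL]] := line22 P NPp.
have LP : inc L P by rewrite (inc_sym arc).
set c := \sum_(Q | inc L Q) N Q in cL.
have c3 : c <= 3.
  have : \sum_(Q | inc L Q) 6 * N Q <= T L.
    by apply: leq_sum => Q _; case NQ: (N Q) => //; have [->] := NP NQ.
  by rewrite -big_distrr /= -/c TL; lia.
have u2 Q : inc L Q -> ~~ N Q -> u Q = 2.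
  move=> LQ nQ.
  have [/existsP [M /andP [QM /eqP TM]]|/existsPn no] :=
    boolP [exists M, inc Q M && (T M == 26)].
    by have [_ h] := line26_strong TM; apply: h; rewrite // (inc_sym arc).
  (* If no line class through [Q] has [T M = 26], one that contains a two-triple class must be its
     3300 direction, and [line22] fixes the number of such classes on it as [n - 12 = c]. *)
  have leM M : inc Q M -> \sum_(R | inc M R) N R <= c /\
      (0 < \sum_(R | inc M R) N R -> T M = 22).
    move=> QM; have [/existsP [R /andP [MR NR]]|/existsPn noR] :=
      boolP [exists R, inc M R && N R]; last first.
      by rewrite big1 // => R MR; have := noR R; rewrite MR /= => /negbTE ->.
    have RM : inc R M by rewrite (inc_sym arc).
    have TM := N_T NR RM; have := no M; rewrite QM /= TM.
    case: (S R M =P p3300) => // eM _; split=> //.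
    have [M' [RM' eM' _ cM']] := line22 R NR.
    suff -> : M = M' by lia.
    apply/eqP; apply: contraT => MM'; have [_ + _ _] := NP NR.
    by rewrite /cnt (bigD1 M) //= (bigD1 M') /= ?RM' 1?eq_sym ?MM' // eM eM'.
  have := sum_count N Q; rewrite (negbTE nQ) muln0 addn0 -/n => sN.
  have le : \sum_(M | inc Q M) \sum_(R | inc M R) N R <= \sum_(M | inc Q M) c.
    by apply: leq_sum => M /leM [].
  (* From [c + 12 = n <= 5 * c] and [c <= 3] follow [c = 3] and [n = 15], with equality on all five
     line classes. *)
  have c_3 : c = 3 by move: le; rewrite sN sum_const; lia.
  have := leqif_sum (fun M QM => leqif_geq (proj1 (leM M QM))).
  move=> [_ /esym]; rewrite sN sum_const c_3 -cL c_3 eqxx => /forall_inP h.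
  (* All five totals are 22, so [110 = 102 + 4 * u Q]. *)
  have := sum_T Q; rewrite (eq_bigr (fun=> 22)) => [|M QM].
    by rewrite sum_const; lia.
  by apply: (proj2 (leM M QM)); apply: leq_trans (h M QM).
have [w [f [fL Sw uw w7]]] := line_class arc L.
apply: (net_total22 w7).
  by rewrite -TL /T fL /total sumnE big_map; apply: eq_bigr => d _; rewrite uw.
move=> d; rewrite -Sw -uw; have Lf := pencil_mem fL d.
have fdL : inc (f d) L by rewrite (inc_sym arc).
case Nd: (N (f d)); last by right; apply: u2; rewrite ?Nd.
by left; have := N_T Nd fdL; rewrite TL; case: eqP.
Qed.

Let T_le25 L : T L <= 25.
Proof.
have : m = 0 by rewrite -n_eq_m /n big1 // => P _; rewrite (negbTE (N_empty P)).
move/eqP; rewrite sum_nat_eq0 => /forallP/(_ L) /=; have := T_le26 L; lia.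
Qed.

(** Six points would need line totals adding up to [102 + 24 = 126], above [5 * 25]. *)
Let u_le5 P : u P <= 5.
Proof.
rewrite leqNgt; apply/negP => u6.
have : \sum_(L | inc P L) T L <= \sum_(L | inc P L) 25.
  by apply: leq_sum => L _.
by rewrite sum_T sum_const; have := u_le6 P; lia.
Qed.

Lemma no_arc102 : False.
Proof.
have def : \sum_P (5 - u P) = 3.
  have : \sum_P ((5 - u P) + u P) = \sum_(P : V) 5.
    by apply: eq_bigr => P _; rewrite subnK.
  by rewrite big_split /= sum_u sum_nat_const (card_plane arc); lia.
have [/existsP [L /forall_inP full]|/existsPn no] :=
  boolP [exists L, [forall (P | inc L P), u P == 5]]; last first.
  (* Otherwise each of the 21 line classes meets the deficiency, but a total deficiency of 3 reaches
     only [5 * 3 = 15]. *)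
  have : \sum_(L : V) 1 <= \sum_L \sum_(P | inc L P) (5 - u P).
    apply: leq_sum => L _; have := no L; rewrite negb_forall.
    case/existsP => P; rewrite negb_imply => /andP [LP u5].
    rewrite (bigD1 P) //=; have := u_le5 P; lia.
  rewrite sum1_card (card_plane arc) (exchange_big_dep predT) //=.
  rewrite (eq_bigr (fun P => 5 * (5 - u P))) => [|P _].
    by rewrite -big_distrr /= def.
  by rewrite -(sum_const P); apply: eq_bigl => L; rewrite (inc_sym arc).
have [w [f [fL Sw uw w7]]] := line_class arc L.
apply: (net_total25 w7) => d; rewrite -Sw.
have Lf := pencil_mem fL d; have [_ _ h] := class_types (f d).
by apply: h; [apply/eqP/full|rewrite (inc_sym arc)].
Qed.

End Arc102.

Local Open Scope ring_scope.

(** * Coordinates for PG(2,4) *)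

Notation plane := (F4 * F4 + option F4)%type.
Notation triple := (F4 * F4 * F4)%type.

Definition coords (v : plane) : triple :=
  match v with
  | inl (s, t) => (1, s, t)
  | inr (Some t) => (0, 1, t)
  | inr None => (0, 0, 1)
  end.

Definition dot (x y : triple) : F4 := x.1.1 * y.1.1 + x.1.2 * y.1.2 + x.2 * y.2.

(** Points and lines share one coordinate type, which makes incidence symmetric. *)
Definition inc (v w : plane) := dot (coords v) (coords w) == 0.

(* Representatives of F_4^3 modulo the span of [coords v]. *)
Definition transv (v : plane) (a : F4 * F4) : triple :=
  match v with
  | inl _ => (0, a.1, a.2)
  | inr (Some _) => (a.1, 0, a.2)
  | inr None => (a.1, a.2, 0)
  end.

(* The functional vanishing on [coords v] and equal to [lin d] on [transv v]. *)
Definition pencil_vec (v : plane) (d : option F4) : triple :=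
  match v, d with
  | inl (s, t), Some r => (s + t * r, 1, r)
  | inl (s, t), None => (t, 0, 1)
  | inr (Some t), Some r => (1, t * r, r)
  | inr (Some t), None => (0, t, 1)
  | inr None, Some r => (1, r, 0)
  | inr None, None => (0, 1, 0)
  end.

Definition lead (x : triple) : F4 :=
  if x.1.1 != 0 then x.1.1 else if x.1.2 != 0 then x.1.2 else x.2.

Definition normalize (x : triple) : plane :=
  if x.1.1 != 0 then inl (x.1.2 / x.1.1, x.2 / x.1.1)
  else if x.1.2 != 0 then inr (Some (x.2 / x.1.2)) else inr None.

Definition pencil_line (v : plane) (d : option F4) := normalize (pencil_vec v d).
Definition pencil_scale (v : plane) (d : option F4) : F4 := (lead (pencil_vec v d))^-1.

Definition planes : seq plane := [seq inl p | p <- pts16] ++ [seq inr d | d <- dirs].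

Lemma mem_planes v : v \in planes.
Proof. by case: v => [[[] []]|[[]|]]. Qed.

Lemma uniq_planes : uniq planes. Proof. by vm_compute. Qed.

Lemma forall_plane (p : pred plane) : all p planes -> forall v, p v.
Proof. by move/allP => h v; apply/h/mem_planes. Qed.

Lemma forall_dir (p : pred (option F4)) : all p dirs -> forall d, p d.
Proof. by move/allP => h d; apply/h/mem_dirs. Qed.

Lemma forall_pts16 (p : pred (F4 * F4)) : all p pts16 -> forall a, p a.
Proof. by move/allP => h a; apply/h/mem_pts16. Qed.

Lemma sum_planes (A : pred plane) (F : plane -> nat) :
  (\sum_(v | A v) F v = \sum_(v <- planes | A v) F v)%N.
Proof.
apply: perm_big; apply: uniq_perm; first exact: index_enum_uniq.
- exact: uniq_planes.
- by move=> v; rewrite mem_planes mem_index_enum.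
Qed.

Lemma sum_pts16 (A : pred (F4 * F4)) (F : F4 * F4 -> nat) :
  (\sum_(a | A a) F a = \sum_(a <- pts16 | A a) F a)%N.
Proof.
apply: perm_big; apply: uniq_perm; first exact: index_enum_uniq.
- by vm_compute.
- by move=> a; rewrite mem_pts16 mem_index_enum.
Qed.

Lemma inc_symmetric : symmetric inc.
Proof. by move=> v w; rewrite /inc /dot; congr (_ == _); ring. Qed.

Lemma pencil_linesP v : pencil (pencil_line v) (inc v).
Proof.
move=> F; rewrite sum_planes -big_filter.
have e : perm_eq [seq w <- planes | inc v w] [seq pencil_line v d | d <- dirs].
  by move: v; apply: forall_plane; vm_compute.
by rewrite (perm_big _ e) big_map.
Qed.

Lemma pencil_scale_neq0 v d : pencil_scale v d != 0.
Proof.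
by move: v; apply: forall_plane; move: d; apply: forall_dir; vm_compute.
Qed.

Lemma dot_pencil v d a :
  dot (coords (pencil_line v d)) (transv v a) = pencil_scale v d * lin d a.
Proof.
apply/eqP; move: v; apply: forall_plane; move: d; apply: forall_dir.
move: a; apply: forall_pts16; by vm_compute.
Qed.

Lemma dotC x y : dot x y = dot y x. Proof. by rewrite /dot; ring. Qed.

Lemma plane_card : #|{: plane}| = 21%N.
Proof. by rewrite card_sum card_prod card_option F4_card. Qed.

Lemma common_lines (P Q : plane) :
  (\sum_(L | inc P L && inc L Q) 1 = 1 + 4 * (P == Q))%N.
Proof.
rewrite sum_planes sum1_count; apply/eqP.
move: Q; apply: forall_plane; move: P; apply: forall_plane; by vm_compute.
Qed.

Lemma plane_sum_inc (P : plane) (F : plane -> nat) :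
  (\sum_(L | inc P L) \sum_(Q | inc L Q) F Q = \sum_Q F Q + 4 * F P)%N.
Proof.
rewrite (exchange_big_dep predT) //=.
rewrite (eq_bigr (fun Q => F Q + 4 * (P == Q) * F Q)%N) => [|Q _].
  rewrite big_split /=; congr (_ + _)%N.
  rewrite (bigD1 P) //= eqxx muln1 big1 ?addn0 // => Q.
  by rewrite eq_sym => /negbTE ->; rewrite muln0.
by rewrite sum_nat_const -sum1_card common_lines mulnDl mul1n.
Qed.

(** * Arcs in coordinates *)

Definition frob (e : bool) (x : F4) : F4 := if e then x ^+ 2 else x.

Lemma frobK e : involutive (frob e). Proof. by case: e => [[]|]. Qed.
Lemma frobD e x y : frob e (x + y) = frob e x + frob e y.
Proof. by case: e x y => [[] []|]. Qed.
Lemma frobM e x y : frob e (x * y) = frob e x * frob e y.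
Proof. by case: e x y => [[] []|]. Qed.
Lemma frob_eq0 e x : (frob e x == 0) = (x == 0).
Proof. by case: e x => [[]|]. Qed.

Definition frob3 e (x : triple) : triple := (frob e x.1.1, frob e x.1.2, frob e x.2).

Definition frobp e (v : plane) : plane :=
  match v with
  | inl p => inl (frob e p.1, frob e p.2)
  | inr d => inr (omap (frob e) d)
  end.

Lemma frobpK e : involutive (frobp e).
Proof. by move=> [[s t]|[t|]] //=; rewrite ?frobK. Qed.

Lemma coords_frobp e v : coords (frobp e v) = frob3 e (coords v).
Proof. by case: v => [[s t]|[t|]]; rewrite /frob3 /=; case: e. Qed.

Lemma transv_frobp e v a : transv (frobp e v) a = transv v a.
Proof. by case: v => [[s t]|[t|]]. Qed.

Lemma inc_frobp e v w : inc (frobp e v) (frobp e w) = inc v w.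
Proof.
rewrite /inc !coords_frobp -[RHS](frob_eq0 e); congr (_ == _).
by rewrite /dot !frobD !frobM.
Qed.

(* A line class sees its point classes through the conjugate plane, since a
   scalar crosses the uniformizer at the cost of a Frobenius twist. *)
Definition class_point e L d := frobp e (pencil_line (frobp e L) d).

Lemma pencil_points e L : pencil (class_point e L) (inc L).
Proof.
move=> F; rewrite (reindex_inj (inv_inj (frobpK e))) /=.
rewrite (eq_bigl (inc (frobp e L))) => [|v]; first exact: pencil_linesP.
by rewrite -(inc_frobp e (frobp e L) v) frobpK.
Qed.

Lemma dot_class_point e L d b :
  dot (transv L b) (frob3 e (coords (class_point e L d))) =
  pencil_scale (frobp e L) d * lin d b.
Proof. by rewrite -coords_frobp frobpK -(transv_frobp e) dotC dot_pencil. Qed.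

(** An affine substitution permutes the four parallel lines, and sorting forgets their order. This
    reconciles the labels used by point classes and line classes. *)
Lemma profile_affine (l c : F4) f : l != 0 ->
  profile (fun t => f (c + l * t)) = profile f.
Proof.
move=> l0; apply/sort_geqP; rewrite -[values _]/(map _ _).
have -> : [seq f (c + l * t) | t <- elts] = [seq f t | t <- [seq c + l * t | t <- elts]].
  by rewrite -map_comp.
by rewrite perm_map //; case: l c l0 => [] [].
Qed.

Definition slice (J : {set plane * (F4 * F4)}) (v L : plane) (t : F4) : nat :=
  count (fun a => ((v, a) \in J) && (dot (coords L) (transv v a) == t)) pts16.

Lemma sumn_count (U : pred (F4 * F4)) (g : F4 * F4 -> F4) :
  sumn (values (fun t => count (fun a => U a && (g a == t)) pts16)) = count U pts16.
Proof.
rewrite /values; elim: pts16 => // a s IH.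
by rewrite /= in IH *; rewrite -IH; case: (U a); case: (g a) => /=; lia.
Qed.

Section Coordinates.

Variables (e : bool) (kap : triple -> triple -> F4).
Variable J : {set plane * (F4 * F4)}.

(** The residue and the radical part of the line equation both vanish at the generator, as computed
    in [mk3_dot]; characteristic 2 turns the second into an equality. *)
Definition incident (p : plane * (F4 * F4)) (L : plane) (b : F4 * F4) :=
  inc L p.1 && (dot (coords L) (transv p.1 p.2) ==
    kap (coords L) (coords p.1) + dot (transv L b) (frob3 e (coords p.1))).

Hypothesis J7 : forall L b, (#|[set p in J | incident p L b]| <= 7)%N.

Lemma sum_pairs (A : pred (plane * (F4 * F4))) :
  (#|[set p in J | A p]| =
   \sum_v count (fun a => ((v, a) \in J) && A (v, a)) pts16)%N.
Proof.
rewrite -sum1dep_card (eq_bigl (fun p => true && (((p.1, p.2) \in J) && A (p.1, p.2)))).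
  rewrite -(pair_big_dep (fun=> true) (fun v a => ((v, a) \in J) && A (v, a)) (fun _ _ => 1%N)) /=.
  by apply: eq_bigr => v _; rewrite sum_pts16 sum1_count.
by case.
Qed.

Lemma coordinates_arc : hjelmslev_arc inc (fun v L => profile (slice J v L))
  (fun v => count (fun a => (v, a) \in J) pts16).
Proof.
split; [exact: inc_symmetric|exact: plane_card|exact: plane_sum_inc| |].
  move=> v; exists (fun a => (v, a) \in J), (pencil_line v); split=> //.
    exact: pencil_linesP.
  move=> d; have l0 := pencil_scale_neq0 v d.
  rewrite -(profile_affine 0 (slice J v _) l0).
  congr sort; apply: eq_map => t; apply: eq_count => a.
  by rewrite dot_pencil add0r (inj_eq (mulfI l0)).
move=> L; pose l d := pencil_scale (frobp e L) d.
(* By [dot_class_point], the lines [b] with [lin d b = t] meet this class in the segment with this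
   label. *)
pose w d t := slice J (class_point e L d) L
  (kap (coords L) (coords (class_point e L d)) + l d * t).
have l0 d : l d != 0 by apply: pencil_scale_neq0.
have prof d : profile (w d) = profile (slice J (class_point e L d) L).
  exact: profile_affine.
exists w, (class_point e L); split=> [|d|d|b].
- exact: pencil_points.
- by rewrite prof.
- by rewrite -sumn_profile prof sumn_profile sumn_count.
- apply: leq_trans (J7 L b); rewrite sum_pairs sumnE big_map.
  pose c v := count (fun a => ((v, a) \in J) && incident (v, a) L b) pts16.
  rewrite -[leqRHS]/(\sum_v c v)%N [leqRHS](bigID (inc L)).
  apply: leq_trans (leq_addr _ _); rewrite (eq_bigl (inc L)) // (pencil_points e L).
  rewrite eq_leq //; apply: eq_bigr => d _; apply: eq_count => a.
  by rewrite /incident (pencil_mem (pencil_points e L)) dot_class_point.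
Qed.

Lemma coordinates_no102 : #|J| = 102%N -> False.
Proof.
move=> cJ; apply: (no_arc102 coordinates_arc); rewrite -cJ.
have -> : J = [set p in J | predT p] by apply/setP => p; rewrite inE andbT.
rewrite sum_pairs; apply: eq_bigr => v _; apply: eq_count => a.
by rewrite !inE !andbT.
Qed.

End Coordinates.

(** * Points and lines of the Hjelmslev plane *)

Lemma rcombE (R : finNzRingType) k (B : {ffun 'I_k -> 'rV[R]_3}) c m :
  rcomb B c 0 m = \sum_(i < k) B i 0 m * c i.
Proof. by rewrite /rcomb summxE; apply: eq_bigr => i _; rewrite mxE. Qed.

(** Solving the equation for coordinate [i0] leaves the other two coordinates free, which gives the
    basis [B]. *)
Lemma hyperplane_line (R : finNzRingType) (c : 'I_3 -> R) i0 : c i0 = 1 ->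
  PHG_line [set x : 'rV[R]_3 | \sum_i c i * x 0 i == 0].
Proof.
move=> c1; pose B : {ffun 'I_2 -> 'rV[R]_3} := [ffun j : 'I_2 =>
  \row_i ((i == lift i0 j)%:R - (i == i0)%:R * c (lift i0 j))].
have Bl r (j : 'I_2) : rcomb B r 0 (lift i0 j) = r j.
  rewrite rcombE (bigD1 j) //= ffunE mxE eqxx eq_sym (negbTE (neq_lift _ _)).
  rewrite mul0r subr0 mul1r big1 ?addr0 // => k kj; rewrite ffunE mxE.
  rewrite [lift i0 j == i0]eq_sym (negbTE (neq_lift _ _)) mul0r subr0.
  by rewrite (inj_eq lift_inj) eq_sym (negbTE kj) mul0r.
have B0 r : rcomb B r 0 i0 = - \sum_(j < 2) c (lift i0 j) * r j.
  rewrite rcombE -sumrN; apply: eq_bigr => j _; rewrite ffunE mxE eqxx.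
  by rewrite (negbTE (neq_lift _ _)) sub0r mul1r mulNr.
have split_sum (x : 'rV[R]_3) : \sum_i c i * x 0 i =
    x 0 i0 + \sum_(j < 2) c (lift i0 j) * x 0 (lift i0 j).
  by rewrite (bigD1_ord i0) //= c1 mul1r.
apply/existsP; exists B; apply/andP; split.
  apply/injectiveP => r s e; apply/ffunP => j.
  by rewrite -Bl e Bl.
apply/eqP/setP => x; rewrite inE split_sum; apply/eqP/imsetP => [x0|[r _ ->]].
  exists [ffun j => x 0 (lift i0 j)] => //; apply/rowP => i.
  case: (unliftP i0 i) => [j ->|->]; first by rewrite Bl ffunE.
  rewrite B0; under eq_bigr => j _ do rewrite ffunE.
  by apply/eqP; rewrite -addr_eq0 x0.
by rewrite B0; under [X in _ + X]eq_bigr => j _ do rewrite Bl; rewrite addNr.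
Qed.

(* [mk a b] plays the role of [a + b * theta], where [theta] generates the radical,
   [theta * c = frob e c * theta], and residues are lifted multiplicatively. *)
Section ChainRing.

Variables (R : finNzRingType) (mk : F4 -> F4 -> R) (e : bool) (carry : F4 -> F4 -> F4).
Hypothesis mk_surj : forall r, exists a b, r = mk a b.
Hypothesis mkM : forall a b c d, mk a b * mk c d = mk (a * c) (a * d + b * frob e c).
Hypothesis mkD : forall a b c d, mk a b + mk c d = mk (a + c) (b + d + carry a c).
Hypothesis mk00 : mk 0 0 = 0.
Hypothesis mk10 : mk 1 0 = 1.
Hypothesis mk01 : mk 0 1 != 0.

Definition entry (x : triple) (i : 'I_3) : F4 :=
  match (i : nat) with 0 => x.1.1 | 1 => x.1.2 | _ => x.2 end.

Definition mk3 (x y : triple) (i : 'I_3) : R := mk (entry x i) (entry y i).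

Definition gen (v : plane) (a : F4 * F4) : 'rV[R]_3 := \row_i mk3 (coords v) (transv v a) i.

Definition span1 (x : 'rV[R]_3) : {set 'rV[R]_3} := [set rscale x r | r : R].

Definition hline (L : plane) (b : F4 * F4) : {set 'rV[R]_3} :=
  [set x : 'rV[R]_3 | \sum_i mk3 (coords L) (transv L b) i * x 0 i == 0].

Definition pivot (v : plane) : 'I_3 :=
  match v with inl _ => inord 0 | inr (Some _) => inord 1 | inr None => inord 2 end.

Lemma mk3_pivot v a : mk3 (coords v) (transv v a) (pivot v) = 1.
Proof. by rewrite -mk10; case: v => [[s t]|[t|]]; rewrite /mk3 /entry /= inordK. Qed.

Lemma hline_line L b : PHG_line (hline L b).
Proof. exact: (hyperplane_line (mk3_pivot L b)). Qed.

(** Collects the carries produced when the three products are added from left to right. *)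
Definition kap (h x : triple) : F4 :=
  carry (h.1.1 * x.1.1) (h.1.2 * x.1.2) +
  carry (h.1.1 * x.1.1 + h.1.2 * x.1.2) (h.2 * x.2).

Lemma F4addrr (x : F4) : x + x = 0. Proof. by case: x. Qed.

Lemma mk3_dot h g x y : \sum_i mk3 h g i * mk3 x y i =
  mk (dot h x) (dot h y + (kap h x + dot g (frob3 e x))).
Proof.
rewrite 3!big_ord_recr big_ord0 /= add0r /mk3 /entry /= !mkM !mkD /dot /kap /frob3 /=.
by congr mk; ring.
Qed.

Lemma incident_sub v a L b : incident e kap (v, a) L b ->
  span1 (gen v a) \subset hline L b.
Proof.
case/andP => /eqP /= h0 /eqP h1; apply/subsetP => _ /imsetP [r _ ->].
rewrite inE; under eq_bigr => i _ do rewrite !mxE mulrA.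
by rewrite -mulr_suml mk3_dot h0 h1 F4addrr mk00 mul0r.
Qed.

(** The inverse comes with a nonzero residue so that it can be inverted in turn. *)
Lemma mk_rinv a b : a != 0 -> exists2 s : R, mk a b * s = 1 &
  exists a' b', [/\ s = mk a' b' & a' != 0].
Proof.
move=> a0; exists (mk a^-1 (- (a^-1 * (b * frob e a^-1)))).
  by rewrite mkM mulfV // mulrN mulVKf // addNr mk10.
by do 2!eexists; split; [reflexivity|rewrite invr_eq0].
Qed.

Lemma rscaleA (x : 'rV[R]_3) r s : rscale (rscale x r) s = rscale x (r * s).
Proof. by apply/rowP => i; rewrite !mxE mulrA. Qed.

Lemma span1_unit (x : 'rV[R]_3) s s' : s * s' = 1 -> span1 (rscale x s) = span1 x.
Proof.
move=> ss'; apply/setP => y; apply/imsetP/imsetP => [[r _ ->]|[r _ ->]].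
  by exists (s * r) => //; rewrite rscaleA.
by exists (s' * r) => //; rewrite rscaleA mulrA ss' mul1r.
Qed.

Lemma row_gen (x : 'rV[R]_3) v : 
  (forall i, exists b, x 0 i = mk (entry (coords v) i) b) ->
  x 0 (pivot v) = 1 -> exists a, x = gen v a.
Proof.
move=> h x1; have [b0 e0] := h (inord 0); have [b1 e1] := h (inord 1).
have [b2 e2] := h (inord 2).
have row3 (z : 'rV[R]_3) : x 0 (inord 0) = z 0 (inord 0) ->
   x 0 (inord 1) = z 0 (inord 1) -> x 0 (inord 2) = z 0 (inord 2) -> x = z.
  move=> z0 z1 z2; apply/rowP => i; rewrite -(inord_val i).
  by case: i => [[|[|[]]]].
rewrite /entry !inordK // in e0 e1 e2.
case: v x1 {h} e0 e1 e2 => [[s t]|[t|]] /= x1 e0 e1 e2.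
- exists (b1, b2); apply: row3; rewrite ?mxE /mk3 /entry ?inordK //= ?mk10 //.
- exists (b0, b2); apply: row3; rewrite ?mxE /mk3 /entry ?inordK //= ?mk10 //.
- exists (b0, b1); apply: row3; rewrite ?mxE /mk3 /entry ?inordK //= ?mk10 //.
Qed.

(** Scaling by an inverse of the first unit entry makes that entry 1 and keeps the earlier ones in
    the radical, so the residues are normalized coordinates. *)
Lemma point_gen P : PHG_point P -> exists v a, P = span1 (gen v a).
Proof.
case/existsP => B /andP [/injectiveP injB /eqP ->]; set x := B 0.
have -> : [set rcomb B c | c : {ffun 'I_1 -> R}] = span1 x.
  apply/setP => y; apply/imsetP/imsetP => [[c _ ->]|[r _ ->]].
    by exists (c 0) => //; rewrite /rcomb big_ord1.
  by exists [ffun=> r] => //; rewrite /rcomb big_ord1 ffunE.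
have [i0 [i0_unit i0_min]] : exists i0 : 'I_3, (exists a b, x 0 i0 = mk a b /\ a != 0) /\
    forall i : 'I_3, (i < i0)%N -> exists b, x 0 i = mk 0 b.
  have dich i : (exists b, x 0 i = mk 0 b) \/ (exists a b, x 0 i = mk a b /\ a != 0).
    have [a [b ->]] := mk_surj (x 0 i); have [->|a0] := eqVneq a 0.
      by left; exists b.
    by right; exists a, b.
  have [r0|u0] := dich (inord 0); last first.
    by exists (inord 0); split=> // i; rewrite inordK.
  have [r1|u1] := dich (inord 1); last first.
    exists (inord 1); split=> // i; rewrite inordK // ltnS leqn0 => /eqP i0.
    by rewrite -(inord_val i) i0.
  have [r2|u2] := dich (inord 2); last first.
    exists (inord 2); split=> // i; rewrite inordK // => i2.
    by rewrite -(inord_val i); case: i i2 => [[|[|[]]]].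
  (* If all entries lie in the radical, [mk 0 1] annihilates [x], against freeness. *)
  have x0 i : x 0 i * mk 0 1 = 0.
    have [b ->] : exists b, x 0 i = mk 0 b.
      by rewrite -(inord_val i); case: i => [[|[|[]]]].
    by rewrite mkM mul0r mul0r add0r; have /eqP -> : frob e 0 == 0 :> F4;
      rewrite ?frob_eq0 // mulr0 mk00.
  have /injB /ffunP /(_ 0) : rcomb B [ffun=> mk 0 1] = rcomb B [ffun=> 0].
    apply/rowP => i; rewrite !rcombE !big_ord1 !ffunE mulr0; exact: x0.
  by rewrite !ffunE => /eqP; rewrite (negbTE mk01).
have [a [b [xi a0]]] := i0_unit; have [s ss [a' [b' [se a'0]]]] := mk_rinv b a0.
have [s' ss' _] := mk_rinv b' a'0; rewrite -se in ss'.
rewrite -(span1_unit x ss').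
have y1 : rscale x s 0 i0 = 1 by rewrite mxE xi.
have y0 (i : 'I_3) : (i < i0)%N -> exists b, rscale x s 0 i = mk 0 b.
  by move=> /i0_min [c ec]; rewrite mxE ec se mkM mul0r mul0r add0r; eexists.
set y := rscale x s in y1 y0 *.
have ex v : (forall i, exists b, y 0 i = mk (entry (coords v) i) b) ->
    i0 = pivot v -> exists w c, span1 y = span1 (gen w c).
  by move=> h iv; have [|c ->] := row_gen h; [rewrite -iv|exists v, c].
have y1' : exists b, y 0 i0 = mk 1 b by exists 0; rewrite y1 mk10.
have [s1 [d1 e1]] := mk_surj (y 0 (inord 1)).
have [s2 [d2 e2]] := mk_surj (y 0 (inord 2)).
have all3 v : (exists b, y 0 (inord 0) = mk (coords v).1.1 b) ->
  (exists b, y 0 (inord 1) = mk (coords v).1.2 b) ->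
  (exists b, y 0 (inord 2) = mk (coords v).2 b) ->
  forall i, exists b, y 0 i = mk (entry (coords v) i) b.
  move=> h0 h1 h2 i; rewrite -(inord_val i).
  by case: i => [[|[|[]]]] //= ?; rewrite /entry inordK.
have [[i0E|i0E]|i0E] : (i0 = inord 0 \/ i0 = inord 1) \/ i0 = inord 2.
  by rewrite -(inord_val i0); case: (i0) => [[|[|[]]]] //= ?; tauto.
- rewrite i0E in y1' y0 ex.
  by apply: (ex (inl (s1, s2))) => //; apply: all3 => //=; eexists; eassumption.
- rewrite i0E in y1' y0 ex; apply: (ex (inr (Some s2))) => //; apply: all3 => //=.
    by apply: y0; rewrite !inordK.
  by eexists; eassumption.
- rewrite i0E in y1' y0 ex.
  by apply: (ex (inr None)) => //; apply: all3 => //=; apply: y0; rewrite !inordK.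
Qed.

Lemma chain_ring_bound : (m_arc R 7 <= 101)%N.
Proof.
apply/bigmax_leqP => K /andP [/forall_inP Kpt /forallP Kline].
rewrite leqNgt; apply/negP => K102.
pose pt (p : plane * (F4 * F4)) := span1 (gen p.1 p.2).
pose code P := odflt (inr None, (F0, F0)) [pick p | pt p == P].
have codeK : {in K, cancel code pt}.
  move=> P /Kpt /point_gen [v [a eP]]; rewrite /code; case: pickP => [p /eqP //|].
  by move/(_ (v, a)); rewrite eP eqxx.
have : (102 <= #|code @: K|)%N by rewrite card_in_imset //; apply: can_in_inj codeK.
(* Exactly 102 codes are kept; the bound 7 on lines passes to the subset. *)
case/card_geqP => s [us ss sK]; pose J := [set p in s].
have cJ : #|J| = 102%N by rewrite cardsE (card_uniqP us).
have JK p : p \in J -> pt p \in K /\ code (pt p) = p.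
  by rewrite inE => /sK /imsetP [P PK ->]; rewrite codeK.
apply: (@coordinates_no102 e kap J _ cJ) => L b.
have /implyP/(_ (hline_line L b)) := Kline (hline L b); apply: leq_trans.
rewrite -(card_in_imset (f := pt)); last first.
  move=> p q; rewrite !inE => /andP [pJ _] /andP [qJ _] epq.
  by rewrite -(JK p _).2 ?inE // epq (JK q _).2 ?inE.
apply/subset_leq_card/subsetP => _ /imsetP [[v a] + ->].
rewrite !inE => /andP [pJ inc_p]; rewrite (JK (v, a) _).1 ?inE //=.
exact: incident_sub.
Qed.

End ChainRing.

(** * The three chain rings *)

Lemma S4_bound : (m_arc S4 7 <= 101)%N.
Proof.
apply: (@chain_ring_bound S4 S4mk false (fun _ _ => 0)) => //.
- by case=> a b; exists a, b.
- by move=> a b c d; rewrite addr0.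
Qed.

Lemma T4_bound : (m_arc T4 7 <= 101)%N.
Proof.
apply: (@chain_ring_bound T4 T4mk true (fun _ _ => 0)) => //.
- by case=> a b; exists a, b.
- by move=> a b c d; rewrite addr0.
Qed.

(** The Teichmüller representatives: 0 and the three cube roots of unity. *)
Definition teich (a : F4) : G4 :=
  match a with
  | F0 => G4mk 0 0 | F1 => G4mk 1 0 | Fw => G4mk 0 1 | Fw2 => G4mk (- 1) (- 1)
  end.

Definition mkG4 (a b : F4) : G4 := teich a + teich b *+ 2.

Definition quads : seq (F4 * F4 * (F4 * F4)) := [seq (p, q) | p <- pts16, q <- pts16].

Lemma forall_quads (p : pred (F4 * F4 * (F4 * F4))) :
  all p quads -> forall a b c d, p ((a, b), (c, d)).
Proof. by move/allP => h a b c d; apply/h/allpairs_f; apply: mem_pts16. Qed.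

Lemma mkG4M a b c d : mkG4 a b * mkG4 c d = mkG4 (a * c) (a * d + b * c).
Proof.
apply/eqP; pose p (x : F4 * F4 * (F4 * F4)) := let: ((a, b), (c, d)) := x in
  mkG4 a b * mkG4 c d == mkG4 (a * c) (a * d + b * c).
by apply: (@forall_quads p); vm_compute.
Qed.

(* The Witt vector carry: in characteristic 2 it is the square root of [a * c],
   and [x ^+ 2] is the square root of [x] in F_4. *)
Lemma mkG4D a b c d :
  mkG4 a b + mkG4 c d = mkG4 (a + c) (b + d + (a * c) ^+ 2).
Proof.
apply/eqP; pose p (x : F4 * F4 * (F4 * F4)) := let: ((a, b), (c, d)) := x in
  mkG4 a b + mkG4 c d == mkG4 (a + c) (b + d + (a * c) ^+ 2).
by apply: (@forall_quads p); vm_compute.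
Qed.

Lemma mkG4_surj r : exists a b, r = mkG4 a b.
Proof.
pose hit (r : G4) := has (fun p => r == mkG4 p.1 p.2) pts16.
suff /hasP [[a b] _ /eqP ->] : hit r by exists a, b.
case: r => [[[|[|[|[|i]]]] ip] [[|[|[|[|j]]]] jp]] //.
all: by vm_compute.
Qed.

Lemma G4_bound : (m_arc G4 7 <= 101)%N.
Proof.
apply: (@chain_ring_bound G4 mkG4 false (fun a c => (a * c) ^+ 2)) => //.
- exact: mkG4_surj.
- exact: mkG4M.
- exact: mkG4D.
- by apply/eqP; vm_compute.
- by apply/eqP; vm_compute.
Qed.

Theorem theorem4p18 :
  [/\ (m_arc G4 7 <= 101)%N, (m_arc S4 7 <= 101)%N & (m_arc T4 7 <= 101)%N].
Proof. by split; [exact: G4_bound|exact: S4_bound|exact: T4_bound]. Qed.
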